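(* Let $X$ and $Y$ be topological spaces and let $\mathbf{q}=(q_\mu):Y\to\mathbf{Y}=(Y_\mu,q_{\mu\mu'},M)$ be an HPol-expansion of $Y$. For $F^*,G^*\in Sh^*(X,Y)$ put $d(F^*,G^* )=\{\mu\in M: q_\mu\circ F^*=q_\mu\circ G^*\}$. Then $d$ is an ultrametric $d:Sh^*(X,Y)\times Sh^*(X,Y)\to(L(M),\le)$.
   Context: HTop is the homotopy category of topological spaces, HPol its full subcategory of spaces having the homotopy type of polyhedra. Inverse systems are indexed by directed sets. Lower classes. For a directed set $(M,\le)$, a subset $\Delta\subseteq M$ is a lower class if $\delta\in\Delta$, $\mu\in M$, $\mu\le\delta$ imply $\mu\in\Delta$. $L(M)$ is the set of all lower classes in $M$, partially ordered by $\Delta\le\Delta'$ iff $\Delta\supseteq\Delta'$; its least element is $M$, denoted $0$. Ultrametric. For a set $S$ and a partially ordered set $(\Gamma,\le)$ with least element $0$, an ultrametric on $S$ is a map $d:S\times S\to\Gamma$ such that for all $x,y,z\in S$, $\gamma\in\Gamma$: (1) $d(x,y)=0$ iff $x=y$; (2) $d(x,y)=d(y,x)$; (3) $d(x,y)\le\gamma$ and $d(y,z)\le\gamma$ imply $d(x,z)\le\gamma$. Pro$^*$-category. For inverse systems $\mathbf{X}=(X_\lambda,p_{\lambda\lambda'},\Lambda)$, $\mathbf{Y}=(Y_\mu,q_{\mu\mu'},M)$ in a category $\mathcal{T}$, an $S^*$-morphism $(f,f^n_\mu):\mathbf{X}\to\mathbf{Y}$ consists of a function $f:M\to\Lambda$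 and $\mathcal{T}$-morphisms $f^n_\mu:X_{f(\mu)}\to Y_\mu$ ($n\in\mathbb{N},\mu\in M$) such that for all $\mu\le\mu'$ there are $\lambda\ge f(\mu),f(\mu')$ and $n\in\mathbb{N}$ with $q_{\mu\mu'}f^{n'}_{\mu'}p_{f(\mu')\lambda}=f^{n'}_\mu p_{f(\mu)\lambda}$ for all $n'\ge n$. Two such, $(f,f^n_\mu)$ and $(f',f'^n_\mu)$, are equivalent if for each $\mu\in M$ there are $\lambda\ge f(\mu),f'(\mu)$ and $n\in\mathbb{N}$ with $f^{n'}_\mu p_{f(\mu)\lambda}=f'^{n'}_\mu p_{f'(\mu)\lambda}$ for all $n'\ge n$. Composition: $(g,g^n_\nu)(f,f^n_\mu)=(fg,\,g^n_\nu f^n_{g(\nu)})$. The category pro$^*$-$\mathcal{T}$ has inverse systems as objects and equivalence classes $[(f,f^n_\mu)]$ as morphisms; pro-$\mathcal{T}$ is regarded as a subcategory by $f^n_\mu=f_\mu$ for all $n$. Expansions. An HPol-expansion of a space $X$ is a morphism $\mathbf{p}=(p_\lambda):X\to\mathbf{X}=(X_\lambda,p_{\lambda\lambda'},\Lambda)$ in pro-HTop with all $X_\lambda$ in HPol such that (E1) each morphism $h:X\to P$ of HTop with $P$ in HPol factors as $h=fp_\lambda$ for some $\lambda$ and $f:X_\lambda\to P$; (E2) if $f_0,f_1:X_\lambda\to P$, $P$ in HPol, satisfy $f_0p_\lambda=f_1p_\lambda$, then $f_0p_{\lambda\lambda'}=f_1p_{\lambda\lambda'}$ for some $\lambda'\ge\lambda$.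 Every space has an HPol-expansion, and any two are related by a unique isomorphism in pro-HPol compatible with the expansion morphisms. Coarse shape category $Sh^*$. Objects: topological spaces. A morphism $F^*:X\to Y$ is a class $\langle\mathbf{f}^*\rangle$ of pro$^*$-HPol morphisms $\mathbf{f}^*:\mathbf{X}\to\mathbf{Y}$ between HPol-expansions of $X$ and $Y$, where $\mathbf{f}^*:\mathbf{X}\to\mathbf{Y}$ and $\mathbf{f}'^*:\mathbf{X}'\to\mathbf{Y}'$ are identified if they correspond under the canonical isomorphisms $\mathbf{X}\cong\mathbf{X}'$, $\mathbf{Y}\cong\mathbf{Y}'$. Composition is by representatives. $Sh^*(X,Y)$ is the set of coarse shape morphisms $X\to Y$. A morphism $f:X\to Y$ of HTop induces a unique $\mathbf{f}:\mathbf{X}\to\mathbf{Y}$ in pro-HPol compatible with the expansions, hence a coarse shape morphism $\mathcal{S}^*(f)$, again written $f$ in compositions such as $q_\mu\circ F^*$. *)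

(* Defs.v *)
From HB Require Import structures.
From mathcomp Require Import all_boot all_order all_algebra.
From mathcomp Require Import finmap.
From mathcomp Require Import all_classical all_reals topology normedtype.

Set Implicit Arguments.
Unset Strict Implicit.
Unset Printing Implicit Defensive.

Import Order.TTheory GRing.Theory Num.Theory numFieldNormedType.Exports.
Local Open Scope classical_set_scope.
Local Open Scope ring_scope.

Reserved Notation "g ∘ f" (at level 40, left associativity).

(* Quotients. The library's [{eq_quot _}] needs a [choiceType], whose universe
   is too small for the collections of expansions below, so a quotient is the
   type of equivalence classes, a class being a predicate. *)

Record equivalence_on (T : Type) := EqRel {
  rel_of :> T -> T -> Prop;
  rel_refl : forall x, rel_of x x;
  rel_sym : forall x y, rel_of x y -> rel_of y x;
  rel_trans : forall x y z, rel_of x y -> rel_of y z -> rel_of x z }.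

Definition quot (T : Type) (e : equivalence_on T) : Type :=
  {C : T -> Prop | exists x, C = e x}.

Section Quotient.
Variables (T : Type) (e : equivalence_on T).

Definition cls (x : T) : quot e := exist _ (e x) (ex_intro _ x erefl).

Definition rep (c : quot e) : T := projT1 (cid (proj2_sig c)).

Lemma repK (c : quot e) : cls (rep c) = c.
Proof.
case: c => C hC; rewrite /cls /rep /=; case: (cid hC) => x /= Cx.
exact: eq_exist.
Qed.

Lemma clsP (x y : T) : cls x = cls y <-> e x y.
Proof.
split=> [/(congr1 (fun c => proj1_sig c y)) /= ->|exy]; first exact: rel_refl.
apply: eq_exist; apply: funext => z; apply: propext; split.
  by apply: rel_trans; exact: rel_sym.
exact: rel_trans.
Qed.

Lemma rep_cls (x : T) : e (rep (cls x)) x.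
Proof. by apply/clsP; rewrite repK. Qed.

Lemma cls_ind (P : quot e -> Prop) : (forall x, P (cls x)) -> forall c, P c.
Proof. by move=> Px c; rewrite -(repK c). Qed.

End Quotient.

Record category := Category {
  obj :> Type;
  Mor : obj -> obj -> Type;
  mid : forall X, Mor X X;
  mcomp : forall X Y Z, Mor Y Z -> Mor X Y -> Mor X Z;
  mcomp_idl : forall X Y (f : Mor X Y), mcomp (mid Y) f = f;
  mcomp_idr : forall X Y (f : Mor X Y), mcomp f (mid X) = f;
  mcompA : forall X Y Z W (h : Mor Z W) (g : Mor Y Z) (f : Mor X Y),
    mcomp h (mcomp g f) = mcomp (mcomp h g) f }.

Arguments Mor {c} X Y : simpl never.
Arguments mid {c} X : simpl never.
Arguments mcomp {c X Y Z} g f : simpl never.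
Notation "g ∘ f" := (mcomp g f).

Definition isomorphic (C : category) (X Y : C) : Prop :=
  exists (f : Mor X Y) (g : Mor Y X), g ∘ f = mid X /\ f ∘ g = mid Y.

Lemma pair_continuous (T A B : topologicalType) (f : T -> A) (g : T -> B) :
  continuous f -> continuous g -> continuous (fun z => (f z, g z)).
Proof. by move=> cf cg z; exact: (cvg_pair (cf z) (cg z)). Qed.

Lemma fst_continuous (A B : topologicalType) : continuous (fst : A * B -> A).
Proof. by move=> z; exact: cvg_fst. Qed.

Lemma snd_continuous (A B : topologicalType) : continuous (snd : A * B -> B).
Proof. by move=> z; exact: cvg_snd. Qed.

Lemma comp_continuous (A B C : topologicalType) (f : A -> B) (g : B -> C) :
  continuous f -> continuous g -> continuous (g \o f).
Proof. by move=> cf cg x; apply: continuous_comp; [exact: cf|exact: cg]. Qed.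

Section Homotopy.
Variable R : realType.

Definition homotopic (X Y : topologicalType) (f g : continuousType X Y) : Prop :=
  exists H : X * R -> Y,
    [/\ {within [set: X] `*` `[0, 1], continuous H},
        forall x, H (x, 0) = f x & forall x, H (x, 1) = g x].

Let clamp (t : R) : R := Num.max 0 (Num.min t 1).

Let clamp_continuous : continuous clamp.
Proof.
move=> t; have c0 : {for t, continuous (cst 0 : R -> R^o)}.
  exact: cst_continuous.
have c1 : {for t, continuous (fun t : R => Num.min t 1 : R^o)}.
  by apply: (@continuous_min R R id (cst 1) t); [exact: cvg_id|
    exact: cst_continuous].
exact: (continuous_max c0 c1).
Qed.

Let clamp01 t : `[0, 1]%classic (clamp t).
Proof.
rewrite /= in_itv /= /clamp le_max lexx /= ge_max ler01 /=.
by rewrite ge_min lexx orbT.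
Qed.

Let clampE t : 0 <= t <= 1 -> clamp t = t.
Proof. by case/andP => t0 t1; rewrite /clamp min_l// max_r. Qed.

Lemma homotopicP (X Y : topologicalType) (f g : continuousType X Y) :
  homotopic f g <-> exists H : X * R -> Y,
    [/\ continuous H, forall x, H (x, 0) = f x & forall x, H (x, 1) = g x].
Proof.
split=> -[H [cH H0 H1]]; last first.
  by exists H; split => //; exact: continuous_subspaceT.
pose c (z : X * R) := (z.1, clamp z.2).
have cc : continuous c.
  apply: pair_continuous; first exact: fst_continuous.
  by apply: comp_continuous; [exact: snd_continuous|exact: clamp_continuous].
exists (H \o c); split.
- move=> z; move/subspace_continuousP : cH => /(_ (c z)) cH.
  have cz : ([set: X] `*` `[0, 1]) (c z) by split => //; exact: clamp01.
  apply: cvg_trans (cH cz) => U; rewrite /nbhs /= => HU.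
  have : nbhs z (c @^-1` [set y | ([set: X] `*` `[0, 1]) y -> (H @^-1` U) y]).
    exact: cc.
  apply: filterS => w /=; apply; split => //; exact: clamp01.
- by move=> x; rewrite /= /c /= clampE ?lexx ?ler01.
- by move=> x; rewrite /= /c /= clampE ?lexx ?ler01.
Qed.

Lemma homotopic_refl (X Y : topologicalType) (f : continuousType X Y) :
  homotopic f f.
Proof.
apply/homotopicP; exists (f \o fst); split => // z.
by apply: continuous_comp; [exact: fst_continuous|exact: cts_fun].
Qed.

Lemma homotopic_sym (X Y : topologicalType) (f g : continuousType X Y) :
  homotopic f g -> homotopic g f.
Proof.
move=> /homotopicP[H [cH H0 H1]]; apply/homotopicP.
exists (fun z => H (z.1, 1 - z.2)); split.
- apply: (@comp_continuous _ _ _ (fun z : X * R => (z.1, 1 - z.2)) H) => //.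
  apply: pair_continuous; first exact: fst_continuous.
  by move=> z; apply: cvgB; [exact: cvg_cst|exact: snd_continuous].
- by move=> x; rewrite /= subr0.
- by move=> x; rewrite /= subrr.
Qed.

Lemma homotopic_trans (X Y : topologicalType) (f g h : continuousType X Y) :
  homotopic f g -> homotopic g h -> homotopic f h.
Proof.
move=> /homotopicP[H [cH H0 H1]] /homotopicP[K [cK K0 K1]]; apply/homotopicP.
pose L (z : X * R) := if z.2 <= 2^-1 then H (z.1, 2 * z.2)
                      else K (z.1, 2 * z.2 - 1).
have cfst : continuous (fst : X * R -> X) by exact: fst_continuous.
have csnd : continuous (snd : X * R -> R) by exact: snd_continuous.
have c2 : continuous (fun z : X * R => 2 * z.2).
  by move=> z; apply: cvgM; [exact: cvg_cst|exact: csnd].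
have c21 : continuous (fun z : X * R => 2 * z.2 - 1).
  by move=> z; apply: cvgB; [exact: c2|exact: cvg_cst].
have cHL : continuous (fun z : X * R => H (z.1, 2 * z.2)).
  exact: (comp_continuous (pair_continuous cfst c2) cH).
have cKL : continuous (fun z : X * R => K (z.1, 2 * z.2 - 1)).
  exact: (comp_continuous (pair_continuous cfst c21) cK).
exists L; split.
- have -> : continuous L = {within [set: X * R], continuous L}.
    by apply: propext; exact: continuous_subspace_setT.
  have -> : [set: X * R] =
      snd @^-1` [set t | t <= 2^-1] `|` snd @^-1` [set t | 2^-1 <= t].
    apply/esym/seteqP; split => // z _ /=.
    by case: (leP z.2 2^-1) => [|/ltW]; [left|right].
  apply: withinU_continuous.
  + by apply: preimage_closed => [z _|]; [exact: csnd|exact: closed_le].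
  + by apply: preimage_closed => [z _|]; [exact: csnd|exact: closed_ge].
  + apply: (@subspace_eq_continuous _ _ _
      (from_subspace _ (fun z : X * R => H (z.1, 2 * z.2)))).
      by move=> z; rewrite inE /= /from_subspace /L => ->.
    exact: continuous_subspaceT.
  + apply: (@subspace_eq_continuous _ _ _
      (from_subspace _ (fun z : X * R => K (z.1, 2 * z.2 - 1)))).
      move=> z; rewrite inE /= /from_subspace /L; case: (ltgtP z.2 2^-1) => // -> _.
      by rewrite divff ?pnatr_eq0 // subrr K0 H1.
    exact: continuous_subspaceT.
- by move=> x; rewrite /L /= invr_ge0 ler0n mulr0.
- move=> x; rewrite /L /= leNgt invf_lt1 ?ltr0n// ltr1n /= mulr1.
  by rewrite (_ : 2 - 1 = 1) // -[2]/(1 + 1)%:R natrD addrK.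
Qed.

Lemma homotopic_compl (X Y Z : topologicalType) (g : continuousType Y Z)
    (f f' : continuousType X Y) :
  homotopic f f' -> homotopic (g \o f : continuousType X Z) (g \o f').
Proof.
move=> /homotopicP[H [cH H0 H1]]; apply/homotopicP; exists (g \o H); split.
- by move=> z; apply: continuous_comp; [exact: cH|exact: cts_fun].
- by move=> x /=; rewrite H0.
- by move=> x /=; rewrite H1.
Qed.

Lemma homotopic_compr (X Y Z : topologicalType) (g g' : continuousType Y Z)
    (f : continuousType X Y) :
  homotopic g g' -> homotopic (g \o f : continuousType X Z) (g' \o f).
Proof.
move=> /homotopicP[H [cH H0 H1]]; apply/homotopicP.
exists (fun z => H (f z.1, z.2)); split => //.
apply: (@comp_continuous _ _ _ (fun z : X * R => (f z.1, z.2)) H) => //.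
apply: pair_continuous; last exact: snd_continuous.
by apply: comp_continuous; [exact: fst_continuous|exact: cts_fun].
Qed.

Definition homotopy_eqrel (X Y : topologicalType) : equivalence_on (continuousType X Y) :=
  EqRel (@homotopic_refl X Y) (@homotopic_sym X Y) (@homotopic_trans X Y).

Definition htop_hom (X Y : topologicalType) : Type := quot (homotopy_eqrel X Y).

Definition htop_id (X : topologicalType) : htop_hom X X :=
  cls (homotopy_eqrel X X) idfun.

Definition htop_comp (X Y Z : topologicalType) (g : htop_hom Y Z)
    (f : htop_hom X Y) : htop_hom X Z :=
  cls (homotopy_eqrel X Z) (rep g \o rep f).

Lemma htop_compE (X Y Z : topologicalType) (g : continuousType Y Z)
    (f : continuousType X Y) :
  htop_comp (cls (homotopy_eqrel Y Z) g) (cls (homotopy_eqrel X Y) f) =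
  cls (homotopy_eqrel X Z) (g \o f).
Proof.
apply/clsP; apply: (@homotopic_trans _ _ _ (g \o rep (cls (homotopy_eqrel X Y) f))).
  by apply: homotopic_compr; exact: (rep_cls (homotopy_eqrel Y Z)).
by apply: homotopic_compl; exact: (rep_cls (homotopy_eqrel X Y)).
Qed.

Lemma htop_comp1m (X Y : topologicalType) (f : htop_hom X Y) :
  htop_comp (htop_id Y) f = f.
Proof.
elim/cls_ind: f => f; rewrite htop_compE; congr cls.
exact/continuousEP.
Qed.

Lemma htop_compm1 (X Y : topologicalType) (f : htop_hom X Y) :
  htop_comp f (htop_id X) = f.
Proof.
elim/cls_ind: f => f; rewrite htop_compE; congr cls.
exact/continuousEP.
Qed.

Lemma htop_compA (X Y Z W : topologicalType) (h : htop_hom Z W)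
    (g : htop_hom Y Z) (f : htop_hom X Y) :
  htop_comp h (htop_comp g f) = htop_comp (htop_comp h g) f.
Proof.
elim/cls_ind: f => f; elim/cls_ind: g => g; elim/cls_ind: h => h.
rewrite !htop_compE; congr cls; exact/continuousEP.
Qed.

Definition HTop : category := Category htop_comp1m htop_compm1 htop_compA.

End Homotopy.

Record simplicial_complex (V : choiceType) := SimplicialComplex {
  simplex : set {fset V};
  simplex_neq0 : forall s, simplex s -> s != fset0;
  simplex_face : forall s t : {fset V},
    simplex s -> (t `<=` s)%fset -> t != fset0 -> simplex t }.

(* A point of the geometric realization, given by its barycentric coordinates. *)
Record realization (R : realType) (V : choiceType) (K : simplicial_complex V) :=
  Realization {
    bary :> {fsfun V -> R with 0};
    bary_simplex : simplex K (finsupp bary);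
    bary_ge0 : forall v, 0 <= bary v;
    bary_sum : \sum_(v <- finsupp bary) bary v = 1 }.

Section Polyhedron.
Variables (R : realType) (V : choiceType) (K : simplicial_complex V).
Notation pt := (realization R K).

HB.instance Definition _ := gen_eqMixin pt.
HB.instance Definition _ := gen_choiceMixin pt.

(* The weak topology: [U] is open when its trace on every closed simplex [|s|]
   is open for the Euclidean topology of [|s|], here given by the maximum
   metric on the coordinates. *)
Definition realization_open (U : set pt) : Prop :=
  forall s, simplex K s -> forall x : pt, U x -> (finsupp x `<=` s)%fset ->
    exists2 e : R, 0 < e &
      forall y : pt, (finsupp y `<=` s)%fset ->
        (forall v, v \in s -> `|x v - y v| < e) -> U y.

Lemma realization_openT : realization_open setT.
Proof. by move=> s _ x _ _; exists 1; rewrite ?ltr01. Qed.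

Lemma realization_openI : setI_closed realization_open.
Proof.
move=> A B oA oB s sK x [Ax Bx] xs.
have [a a0 Aa] := oA s sK x Ax xs; have [b b0 Bb] := oB s sK x Bx xs.
exists (Num.min a b); first by rewrite lt_min a0.
move=> y ys xy; split; [apply: Aa => // v vs|apply: Bb => // v vs];
  by have := xy v vs; rewrite lt_min => /andP[].
Qed.

Lemma realization_open_bigU (I : Type) (f : I -> set pt) :
  (forall i, realization_open (f i)) -> realization_open (\bigcup_i f i).
Proof.
move=> fo s sK x [i _ fix_] xs; have [e e0 fe] := fo i s sK x fix_ xs.
by exists e => // y ys xy; exists i => //; exact: fe.
Qed.

HB.instance Definition _ := @isOpenTopological.Build pt realization_open
  realization_openT realization_openI realization_open_bigU.

End Polyhedron.

Definition HPol (R : realType) (X : topologicalType) : Prop :=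
  exists (V : choiceType) (K : simplicial_complex V),
    @isomorphic (HTop R) X (realization R K).

Record directedSet := DirectedSet {
  dir_disp : Order.disp_t;
  dir_sort :> preorderType dir_disp;
  dir_inhabited : inhabited dir_sort;
  dir_directed : forall x y : dir_sort, exists z, (x <= z)%O /\ (y <= z)%O }.

Record invsys (T : category) := InvSys {
  sys_ix : directedSet;
  sys_obj :> sys_ix -> T;
  bond : forall l l' : sys_ix, (l <= l')%O -> Mor (sys_obj l') (sys_obj l);
  bond_id : forall (l : sys_ix) (h : (l <= l)%O), bond h = mid (sys_obj l);
  bond_comp : forall (l l' l'' : sys_ix) (h : (l <= l')%O) (h' : (l' <= l'')%O)
    (h'' : (l <= l'')%O), bond h ∘ bond h' = bond h'' }.

Arguments bond {T} i {l l'} h.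

Section Pro.
Variable T : category.
Implicit Types X Y Z : invsys T.

(* The relation between sequences that occurs both in the coherence condition
   of an S*-morphism and in the equivalence of S*-morphisms: for some
   l >= a, b and some n, u_n' p_al = v_n' p_bl for all n' >= n. *)
Definition agree X (P : T) (a b : sys_ix X) (u : nat -> Mor (X a) P)
    (v : nat -> Mor (X b) P) : Prop :=
  exists (l : sys_ix X) (ha : (a <= l)%O) (hb : (b <= l)%O) (n : nat),
    forall n', (n <= n')%N -> u n' ∘ bond X ha = v n' ∘ bond X hb.

Lemma agree_refl X (P : T) (a : sys_ix X) (u : nat -> Mor (X a) P) : agree u u.
Proof. by exists a, (lexx a), (lexx a), 0%N. Qed.

Lemma agree_sym X (P : T) (a b : sys_ix X) (u : nat -> Mor (X a) P)
    (v : nat -> Mor (X b) P) : agree u v -> agree v u.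
Proof. by case=> l [ha [hb [n uv]]]; exists l, hb, ha, n => n' /uv. Qed.

Lemma agree_trans X (P : T) (a b c : sys_ix X) (u : nat -> Mor (X a) P)
    (v : nat -> Mor (X b) P) (w : nat -> Mor (X c) P) :
  agree u v -> agree v w -> agree u w.
Proof.
case=> l [ha [hb [n uv]]] [l' [hb' [hc [n' vw]]]].
have [z [lz l'z]] := dir_directed l l'.
exists z, (le_trans ha lz), (le_trans hc l'z), (maxn n n') => k.
rewrite geq_max => /andP[nk n'k].
rewrite -(bond_comp ha lz) -(bond_comp hc l'z) !mcompA uv// -vw//.
by rewrite -!mcompA !(bond_comp _ _ (le_trans hb lz)).
Qed.

Lemma agree_post X (P Q : T) (g : nat -> Mor P Q) (a b : sys_ix X)
    (u : nat -> Mor (X a) P) (v : nat -> Mor (X b) P) :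
  agree u v -> agree (fun n => g n ∘ u n) (fun n => g n ∘ v n).
Proof.
case=> l [ha [hb [n uv]]]; exists l, ha, hb, n => n' nn'.
by rewrite -!mcompA uv.
Qed.

Lemma agree_eventually X (P : T) (a : sys_ix X) (u v : nat -> Mor (X a) P) n :
  (forall n', (n <= n')%N -> u n' = v n') -> agree u v.
Proof. by move=> uv; exists a, (lexx a), (lexx a), n => n' /uv ->. Qed.

Record star_mor X Y := StarMor {
  star_ix : sys_ix Y -> sys_ix X;
  star_fun : forall (n : nat) (m : sys_ix Y), Mor (X (star_ix m)) (Y m);
  star_coh : forall (m m' : sys_ix Y) (h : (m <= m')%O),
    agree (fun n => bond Y h ∘ star_fun n m') (fun n => star_fun n m) }.

Definition star_equiv X Y (f g : star_mor X Y) : Prop :=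
  forall m : sys_ix Y, agree (fun n => star_fun f n m) (fun n => star_fun g n m).

Lemma star_equiv_refl X Y (f : star_mor X Y) : star_equiv f f.
Proof. by move=> m; exact: agree_refl. Qed.

Lemma star_equiv_sym X Y (f g : star_mor X Y) :
  star_equiv f g -> star_equiv g f.
Proof. by move=> fg m; exact/agree_sym/fg. Qed.

Lemma star_equiv_trans X Y (f g h : star_mor X Y) :
  star_equiv f g -> star_equiv g h -> star_equiv f h.
Proof. by move=> fg gh m; exact: agree_trans (fg m) (gh m). Qed.

Definition star_eqrel X Y : equivalence_on (star_mor X Y) :=
  EqRel (@star_equiv_refl X Y) (@star_equiv_sym X Y) (@star_equiv_trans X Y).

Lemma star_id_coh X (m m' : sys_ix X) (h : (m <= m')%O) :
  agree (fun _ : nat => bond X h ∘ mid (X m')) (fun _ => mid (X m)).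
Proof.
exists m', (lexx m'), h, 0%N => _ _.
by rewrite bond_id mcomp_idr mcomp_idr mcomp_idl.
Qed.

Definition star_id X : star_mor X X :=
  @StarMor X X id (fun _ m => mid (X m)) (@star_id_coh X).

(* Pulling a relation between terms of [Y] back along an S*-morphism. *)
Lemma agree_pre X Y (f : star_mor X Y) (P : T) (a b : sys_ix Y)
    (u : nat -> Mor (Y a) P) (v : nat -> Mor (Y b) P) :
  agree u v ->
  agree (fun n => u n ∘ star_fun f n a) (fun n => v n ∘ star_fun f n b).
Proof.
case=> l [ha [hb [n uv]]].
have fa := agree_post u (star_coh f ha); have fb := agree_post v (star_coh f hb).
apply: agree_trans (agree_sym fa) _; apply: agree_trans fb.
by apply: (@agree_eventually _ _ _ _ _ n) => n' nn'; rewrite !mcompA uv.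
Qed.

Lemma star_comp_coh X Y Z (g : star_mor Y Z) (f : star_mor X Y)
    (m m' : sys_ix Z) (h : (m <= m')%O) :
  agree (fun n => bond Z h ∘ (star_fun g n m' ∘ star_fun f n (star_ix g m')))
        (fun n => star_fun g n m ∘ star_fun f n (star_ix g m)).
Proof.
have := agree_pre f (star_coh g h); apply: agree_trans.
by apply: (@agree_eventually _ _ _ _ _ 0%N) => n _; rewrite mcompA.
Qed.

Definition star_comp X Y Z (g : star_mor Y Z) (f : star_mor X Y) : star_mor X Z :=
  @StarMor X Z (fun m => star_ix f (star_ix g m))
    (fun n m => star_fun g n m ∘ star_fun f n (star_ix g m))
    (@star_comp_coh X Y Z g f).

Lemma star_comp_equiv X Y Z (g g' : star_mor Y Z) (f f' : star_mor X Y) :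
  star_equiv g g' -> star_equiv f f' ->
  star_equiv (star_comp g f) (star_comp g' f').
Proof.
move=> gg' ff' m; apply: agree_trans (agree_pre f (gg' m)) _.
exact: agree_post (ff' _).
Qed.

Definition prostar_hom X Y : Type := quot (star_eqrel X Y).

Definition prostar_id X : prostar_hom X X := cls (star_eqrel X X) (star_id X).

Definition prostar_comp X Y Z (g : prostar_hom Y Z) (f : prostar_hom X Y) :
  prostar_hom X Z := cls (star_eqrel X Z) (star_comp (rep g) (rep f)).

Lemma prostar_compE X Y Z (g : star_mor Y Z) (f : star_mor X Y) :
  prostar_comp (cls (star_eqrel Y Z) g) (cls (star_eqrel X Y) f) =
  cls (star_eqrel X Z) (star_comp g f).
Proof.
by apply/clsP; apply: star_comp_equiv; [exact: (rep_cls (star_eqrel Y Z))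
  |exact: (rep_cls (star_eqrel X Y))].
Qed.

Lemma prostar_comp1m X Y (f : prostar_hom X Y) : prostar_comp (prostar_id Y) f = f.
Proof.
elim/cls_ind: f => f; rewrite prostar_compE; apply/clsP => m /=.
by apply: (@agree_eventually _ _ _ _ _ 0%N) => n _; rewrite mcomp_idl.
Qed.

Lemma prostar_compm1 X Y (f : prostar_hom X Y) : prostar_comp f (prostar_id X) = f.
Proof.
elim/cls_ind: f => f; rewrite prostar_compE; apply/clsP => m /=.
by apply: (@agree_eventually _ _ _ _ _ 0%N) => n _; rewrite mcomp_idr.
Qed.

Lemma prostar_compA X Y Z W (h : prostar_hom Z W) (g : prostar_hom Y Z)
    (f : prostar_hom X Y) :
  prostar_comp h (prostar_comp g f) = prostar_comp (prostar_comp h g) f.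
Proof.
elim/cls_ind: f => f; elim/cls_ind: g => g; elim/cls_ind: h => h.
rewrite !prostar_compE; apply/clsP => m /=.
by apply: (@agree_eventually _ _ _ _ _ 0%N) => n _; rewrite mcompA.
Qed.

Definition prostar : category :=
  Category prostar_comp1m prostar_compm1 prostar_compA.

Record pro_mor X Y := ProMor {
  pro_ix : sys_ix Y -> sys_ix X;
  pro_fun : forall m : sys_ix Y, Mor (X (pro_ix m)) (Y m);
  pro_coh : forall (m m' : sys_ix Y) (h : (m <= m')%O),
    exists (l : sys_ix X) (h1 : (pro_ix m <= l)%O) (h2 : (pro_ix m' <= l)%O),
      bond Y h ∘ pro_fun m' ∘ bond X h2 = pro_fun m ∘ bond X h1 }.

Definition pro_equiv X Y (f g : pro_mor X Y) : Prop :=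
  forall m : sys_ix Y,
    exists (l : sys_ix X) (h1 : (pro_ix f m <= l)%O) (h2 : (pro_ix g m <= l)%O),
      pro_fun f m ∘ bond X h1 = pro_fun g m ∘ bond X h2.

Lemma agree_cst X (P : T) (a b : sys_ix X) (u : Mor (X a) P) (v : Mor (X b) P) :
  (exists (l : sys_ix X) (ha : (a <= l)%O) (hb : (b <= l)%O),
     u ∘ bond X ha = v ∘ bond X hb) <->
  agree (fun=> u) (fun=> v).
Proof.
split=> [[l [ha [hb uv]]]|[l [ha [hb [n uv]]]]]; first by exists l, ha, hb, 0%N.
by exists l, ha, hb; exact: uv (leqnn n).
Qed.

Lemma pro_star_coh X Y (f : pro_mor X Y) (m m' : sys_ix Y) (h : (m <= m')%O) :
  agree (fun _ : nat => bond Y h ∘ pro_fun f m') (fun _ => pro_fun f m).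
Proof.
by apply/agree_cst; have [l [h1 [h2 e]]] := pro_coh f h; exists l, h2, h1.
Qed.

Definition pro_star X Y (f : pro_mor X Y) : star_mor X Y :=
  @StarMor X Y (pro_ix f) (fun _ m => pro_fun f m) (@pro_star_coh X Y f).

Lemma pro_star_equiv X Y (f g : pro_mor X Y) :
  star_equiv (pro_star f) (pro_star g) <-> pro_equiv f g.
Proof. by split=> fg m; apply/agree_cst; exact: fg. Qed.

Lemma pro_equiv_refl X Y (f : pro_mor X Y) : pro_equiv f f.
Proof. exact/pro_star_equiv/star_equiv_refl. Qed.

Lemma pro_equiv_sym X Y (f g : pro_mor X Y) : pro_equiv f g -> pro_equiv g f.
Proof. by move=> /pro_star_equiv/star_equiv_sym/pro_star_equiv. Qed.

Lemma pro_equiv_trans X Y (f g h : pro_mor X Y) :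
  pro_equiv f g -> pro_equiv g h -> pro_equiv f h.
Proof.
move=> /pro_star_equiv fg /pro_star_equiv gh; apply/pro_star_equiv.
exact: star_equiv_trans fg gh.
Qed.

Definition pro_eqrel X Y : equivalence_on (pro_mor X Y) :=
  EqRel (@pro_equiv_refl X Y) (@pro_equiv_sym X Y) (@pro_equiv_trans X Y).

Lemma pro_id_coh X (m m' : sys_ix X) (h : (m <= m')%O) :
  exists (l : sys_ix X) (h1 : (m <= l)%O) (h2 : (m' <= l)%O),
    bond X h ∘ mid (X m') ∘ bond X h2 = mid (X m) ∘ bond X h1.
Proof.
have /agree_cst[l [h2 [h1 e]]] := star_id_coh h.
by exists l, h1, h2.
Qed.

Definition pro_idmor X : pro_mor X X :=
  @ProMor X X id (fun m => mid (X m)) (@pro_id_coh X).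

Lemma pro_comp_coh X Y Z (g : pro_mor Y Z) (f : pro_mor X Y)
    (m m' : sys_ix Z) (h : (m <= m')%O) :
  exists (l : sys_ix X) (h1 : (pro_ix f (pro_ix g m) <= l)%O)
    (h2 : (pro_ix f (pro_ix g m') <= l)%O),
    bond Z h ∘ (pro_fun g m' ∘ pro_fun f (pro_ix g m')) ∘ bond X h2 =
    pro_fun g m ∘ pro_fun f (pro_ix g m) ∘ bond X h1.
Proof.
have /= /agree_cst[l [h2 [h1 e]]] := star_comp_coh (pro_star g) (pro_star f) h.
by exists l, h1, h2.
Qed.

Definition pro_compmor X Y Z (g : pro_mor Y Z) (f : pro_mor X Y) : pro_mor X Z :=
  @ProMor X Z (fun m => pro_ix f (pro_ix g m))
    (fun m => pro_fun g m ∘ pro_fun f (pro_ix g m)) (@pro_comp_coh X Y Z g f).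

Lemma pro_comp_equiv X Y Z (g g' : pro_mor Y Z) (f f' : pro_mor X Y) :
  pro_equiv g g' -> pro_equiv f f' ->
  pro_equiv (pro_compmor g f) (pro_compmor g' f').
Proof.
move=> /pro_star_equiv gg' /pro_star_equiv ff' m; apply/agree_cst.
exact: (star_comp_equiv gg' ff' m).
Qed.

Definition pro_hom X Y : Type := quot (pro_eqrel X Y).

Definition pro_id X : pro_hom X X := cls (pro_eqrel X X) (pro_idmor X).

Definition pro_comp X Y Z (g : pro_hom Y Z) (f : pro_hom X Y) : pro_hom X Z :=
  cls (pro_eqrel X Z) (pro_compmor (rep g) (rep f)).

Lemma pro_compE X Y Z (g : pro_mor Y Z) (f : pro_mor X Y) :
  pro_comp (cls (pro_eqrel Y Z) g) (cls (pro_eqrel X Y) f) =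
  cls (pro_eqrel X Z) (pro_compmor g f).
Proof.
by apply/clsP; apply: pro_comp_equiv; [exact: (rep_cls (pro_eqrel Y Z))
  |exact: (rep_cls (pro_eqrel X Y))].
Qed.

Lemma pro_comp1m X Y (f : pro_hom X Y) : pro_comp (pro_id Y) f = f.
Proof.
elim/cls_ind: f => f; rewrite pro_compE; apply/clsP => m /=.
by exists (pro_ix f m), (lexx _), (lexx _); rewrite mcomp_idl.
Qed.

Lemma pro_compm1 X Y (f : pro_hom X Y) : pro_comp f (pro_id X) = f.
Proof.
elim/cls_ind: f => f; rewrite pro_compE; apply/clsP => m /=.
by exists (pro_ix f m), (lexx _), (lexx _); rewrite mcomp_idr.
Qed.

Lemma pro_compA X Y Z W (h : pro_hom Z W) (g : pro_hom Y Z) (f : pro_hom X Y) :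
  pro_comp h (pro_comp g f) = pro_comp (pro_comp h g) f.
Proof.
elim/cls_ind: f => f; elim/cls_ind: g => g; elim/cls_ind: h => h.
rewrite !pro_compE; apply/clsP => m /=.
by exists (pro_ix f (pro_ix g (pro_ix h m))), (lexx _), (lexx _); rewrite mcompA.
Qed.

Definition pro : category := Category pro_comp1m pro_compm1 pro_compA.

Lemma pro_clsE X Y Z (g : pro_mor Y Z) (f : pro_mor X Y) :
  @mcomp pro X Y Z (cls (pro_eqrel Y Z) g) (cls (pro_eqrel X Y) f) =
  cls (pro_eqrel X Z) (pro_compmor g f).
Proof. exact: pro_compE. Qed.

Lemma prostar_clsE X Y Z (g : star_mor Y Z) (f : star_mor X Y) :
  @mcomp prostar X Y Z (cls (star_eqrel Y Z) g) (cls (star_eqrel X Y) f) =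
  cls (star_eqrel X Z) (star_comp g f).
Proof. exact: prostar_compE. Qed.

Definition pro_incl X Y (f : @Mor pro X Y) : @Mor prostar X Y :=
  cls (star_eqrel X Y) (pro_star (rep f)).

Lemma pro_inclE X Y (f : pro_mor X Y) :
  pro_incl (cls (pro_eqrel X Y) f) = cls (star_eqrel X Y) (pro_star f).
Proof. by apply/clsP/pro_star_equiv; exact: (rep_cls (pro_eqrel X Y)). Qed.

Lemma pro_incl_inj X Y : injective (@pro_incl X Y).
Proof.
move=> f g; elim/cls_ind: f => f; elim/cls_ind: g => g.
by rewrite !pro_inclE => /clsP/pro_star_equiv fg; apply/clsP.
Qed.

Lemma pro_incl_id X : pro_incl (@mid pro X) = @mid prostar X.
Proof.
rewrite pro_inclE; apply/clsP => m.
exact: (@agree_eventually _ _ _ _ _ 0%N).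
Qed.

Lemma pro_incl_comp X Y Z (g : @Mor pro Y Z) (f : @Mor pro X Y) :
  pro_incl (g ∘ f) = pro_incl g ∘ pro_incl f.
Proof.
elim/cls_ind: f => f; elim/cls_ind: g => g.
rewrite pro_clsE !pro_inclE prostar_clsE.
by apply/clsP => m; exact: (@agree_eventually _ _ _ _ _ 0%N).
Qed.

(* An object of T as an inverse system indexed by a singleton. *)
Lemma point_directed (x y : 'I_1) : exists z : 'I_1, (x <= z)%O /\ (y <= z)%O.
Proof. by exists (Order.max x y); rewrite !le_max !lexx orbT. Qed.

Lemma point_le (x y : 'I_1) : (x <= y)%O.
Proof. by rewrite (ord1 x) (ord1 y). Qed.

Definition point_dir : directedSet :=
  DirectedSet (inhabits (ord0 : 'I_1)) point_directed.

Lemma const_bond_comp (P : T) : mid P ∘ mid P = mid P.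
Proof. exact: mcomp_idl. Qed.

Definition const_sys (P : T) : invsys T :=
  @InvSys T point_dir (fun=> P) (fun _ _ _ => mid P)
    (fun _ _ => erefl) (fun _ _ _ _ _ _ => const_bond_comp P).

Lemma const_map_coh (P Q : T) (f : Mor P Q) (m m' : sys_ix (const_sys Q))
    (h : (m <= m')%O) :
  exists (l : sys_ix (const_sys P)) (h1 h2 : (ord0 <= l)%O),
    bond (const_sys Q) h ∘ f ∘ bond (const_sys P) h2 =
    f ∘ bond (const_sys P) h1.
Proof. by exists ord0, (lexx _), (lexx _); rewrite /= mcomp_idl. Qed.

Definition const_map (P Q : T) (f : Mor P Q) :
    @Mor pro (const_sys P) (const_sys Q) :=
  cls (pro_eqrel _ _) (@ProMor (const_sys P) (const_sys Q) (fun=> ord0)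
    (fun=> f) (@const_map_coh P Q f)).

End Pro.

Section CoarseShape.
Variable R : realType.
Implicit Types X Y Z : topologicalType.

(* The full subcategory HPol is handled through its objects: all terms of
   [exp_sys] are in HPol, so that the morphisms of pro-HPol and pro*-HPol
   between such systems are those of [pro (HTop R)] and [prostar (HTop R)]. *)
Record expansion X := Expansion {
  exp_sys : invsys (HTop R);
  exp_proj : forall l : sys_ix exp_sys, @Mor (HTop R) X (exp_sys l);
  exp_coh : forall (l l' : sys_ix exp_sys) (h : (l <= l')%O),
    bond exp_sys h ∘ exp_proj l' = exp_proj l;
  exp_HPol : forall l : sys_ix exp_sys, HPol R (exp_sys l);
  exp_E1 : forall P : topologicalType, HPol R P ->
    forall h : @Mor (HTop R) X P,
      exists (l : sys_ix exp_sys) (f : @Mor (HTop R) (exp_sys l) P),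
        h = f ∘ exp_proj l;
  exp_E2 : forall P : topologicalType, HPol R P ->
    forall (l : sys_ix exp_sys) (f0 f1 : @Mor (HTop R) (exp_sys l) P),
      f0 ∘ exp_proj l = f1 ∘ exp_proj l ->
      exists (l' : sys_ix exp_sys) (h : (l <= l')%O),
        f0 ∘ bond exp_sys h = f1 ∘ bond exp_sys h }.

Lemma exp_mor_coh X (p : expansion X) (m m' : sys_ix (exp_sys p))
    (h : (m <= m')%O) :
  exists (l : sys_ix (@const_sys (HTop R) X)) (h1 h2 : (ord0 <= l)%O),
    bond (exp_sys p) h ∘ exp_proj m' ∘ bond (@const_sys (HTop R) X) h2 =
    exp_proj m ∘ bond (@const_sys (HTop R) X) h1.
Proof. by exists ord0, (lexx _), (lexx _); rewrite exp_coh. Qed.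

Definition exp_mor X (p : expansion X) :
    @Mor (pro (HTop R)) (@const_sys (HTop R) X) (exp_sys p) :=
  cls (pro_eqrel _ _) (@ProMor _ (@const_sys (HTop R) X) (exp_sys p)
    (fun=> ord0) (@exp_proj X p) (@exp_mor_coh X p)).

Definition compatible X Y (p : expansion X) (q : expansion Y)
    (f : @Mor (HTop R) X Y)
    (F : @Mor (pro (HTop R)) (exp_sys p) (exp_sys q)) : Prop :=
  F ∘ exp_mor p = exp_mor q ∘ const_map f.

Lemma compatibleP X Y (p : expansion X) (q : expansion Y)
    (f : @Mor (HTop R) X Y) (F : pro_mor (exp_sys p) (exp_sys q)) :
  compatible f (cls (pro_eqrel _ _) F) <->
  forall m, pro_fun F m ∘ exp_proj (pro_ix F m) = exp_proj m ∘ f.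
Proof.
rewrite /compatible !pro_clsE clsP; split=> /= [e m|e m].
  by have [l [h1 [h2]]] := e m; rewrite /= !mcomp_idr.
by exists ord0, (lexx _), (lexx _); rewrite /= e.
Qed.

Lemma induced_exists X Y (p : expansion X) (q : expansion Y)
    (f : @Mor (HTop R) X Y) : exists F, @compatible X Y p q f F.
Proof.
have ex : forall m : sys_ix (exp_sys q),
    exists s : {l : sys_ix (exp_sys p) & @Mor (HTop R) (exp_sys p l) (exp_sys q m)},
      projT2 s ∘ exp_proj (projT1 s) = exp_proj m ∘ f.
  move=> m; have [l [g e]] := exp_E1 p (exp_HPol m) (exp_proj m ∘ f).
  by exists (existT _ l g).
pose s m := projT1 (cid (ex m)).
have fs m : projT2 (s m) ∘ exp_proj (projT1 (s m)) = exp_proj m ∘ f.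
  exact: projT2 (cid (ex m)).
have coh (m m' : sys_ix (exp_sys q)) (h : (m <= m')%O) :
    exists (l : sys_ix (exp_sys p)) (h1 : (projT1 (s m) <= l)%O)
      (h2 : (projT1 (s m') <= l)%O),
      bond (exp_sys q) h ∘ projT2 (s m') ∘ bond (exp_sys p) h2 =
      projT2 (s m) ∘ bond (exp_sys p) h1.
  have [l [h1 h2]] := dir_directed (projT1 (s m)) (projT1 (s m')).
  have [|l' [h' e]] := @exp_E2 _ p _ (exp_HPol m) l
    (bond (exp_sys q) h ∘ projT2 (s m') ∘ bond (exp_sys p) h2)
    (projT2 (s m) ∘ bond (exp_sys p) h1).
    rewrite -!mcompA !exp_coh !fs.
    by rewrite mcompA exp_coh.
  exists l', (le_trans h1 h'), (le_trans h2 h').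
  by rewrite -(bond_comp h1 h') -(bond_comp h2 h') !mcompA.
exists (cls (pro_eqrel _ _) (@ProMor _ (exp_sys p) (exp_sys q)
  (fun m => projT1 (s m)) (fun m => projT2 (s m)) coh)).
exact/compatibleP.
Qed.

Lemma induced_unique X Y (p : expansion X) (q : expansion Y)
    (f : @Mor (HTop R) X Y) F G :
  @compatible X Y p q f F -> @compatible X Y p q f G -> F = G.
Proof.
elim/cls_ind: F => F; elim/cls_ind: G => G /compatibleP cF /compatibleP cG.
apply/clsP => m; have [l [h1 h2]] := dir_directed (pro_ix F m) (pro_ix G m).
have [|l' [h' e]] := @exp_E2 _ p _ (exp_HPol m) l
  (pro_fun F m ∘ bond (exp_sys p) h1) (pro_fun G m ∘ bond (exp_sys p) h2).
  by rewrite -!mcompA !exp_coh cF cG.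
exists l', (le_trans h1 h'), (le_trans h2 h').
by rewrite -(bond_comp h1 h') -(bond_comp h2 h') !mcompA.
Qed.

Definition induced X Y (p : expansion X) (q : expansion Y)
    (f : @Mor (HTop R) X Y) : @Mor (pro (HTop R)) (exp_sys p) (exp_sys q) :=
  projT1 (cid (induced_exists p q f)).

Lemma induced_compatible X Y (p : expansion X) (q : expansion Y)
    (f : @Mor (HTop R) X Y) : compatible f (induced p q f).
Proof. exact: projT2 (cid (induced_exists p q f)). Qed.

Lemma const_map_comp X Y Z (g : @Mor (HTop R) Y Z) (f : @Mor (HTop R) X Y) :
  const_map (g ∘ f) = const_map g ∘ const_map f.
Proof.
rewrite pro_clsE; apply/clsP => m.
by exists ord0, (lexx _), (lexx _).
Qed.

Lemma induced_comp X Y Z (p : expansion X) (q : expansion Y) (r : expansion Z)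
    (g : @Mor (HTop R) Y Z) (f : @Mor (HTop R) X Y) :
  induced q r g ∘ induced p q f = induced p r (g ∘ f).
Proof.
apply: induced_unique (induced_compatible _ _ _).
rewrite /compatible -mcompA induced_compatible mcompA induced_compatible.
by rewrite -mcompA const_map_comp.
Qed.

Lemma induced_id X (p : expansion X) :
  induced p p (@mid (HTop R) X) = @mid (pro (HTop R)) (exp_sys p).
Proof.
apply: induced_unique (induced_compatible _ _ _) _.
rewrite /compatible mcomp_idl.
have -> : const_map (@mid (HTop R) X) =
    @mid (pro (HTop R)) (@const_sys (HTop R) X).
  by apply/clsP => m; exists ord0, (point_le _ _), (point_le _ _).
by rewrite mcomp_idr.
Qed.

(* The canonical isomorphism between two expansions, in pro*-HPol. *)
Definition canon_iso X (p p' : expansion X) :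
    @Mor (prostar (HTop R)) (exp_sys p) (exp_sys p') :=
  pro_incl (induced p p' (@mid (HTop R) X)).

Lemma canon_iso_id X (p : expansion X) :
  canon_iso p p = @mid (prostar (HTop R)) (exp_sys p).
Proof. by rewrite /canon_iso induced_id pro_incl_id. Qed.

Lemma canon_iso_comp X (p p' p'' : expansion X) :
  canon_iso p' p'' ∘ canon_iso p p' = canon_iso p p''.
Proof. by rewrite /canon_iso -pro_incl_comp induced_comp mcomp_idl. Qed.

Lemma canon_isoK X (p p' : expansion X) :
  canon_iso p' p ∘ canon_iso p p' = @mid (prostar (HTop R)) (exp_sys p).
Proof. by rewrite canon_iso_comp canon_iso_id. Qed.

(* Sh*(X, Y) is the quotient of the pro*-HPol morphisms between arbitrary
   expansions of X and Y by correspondence under the canonical isomorphisms. *)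
Record sh_rep X Y := ShRep {
  sh_src : expansion X;
  sh_tgt : expansion Y;
  sh_mor : @Mor (prostar (HTop R)) (exp_sys sh_src) (exp_sys sh_tgt) }.

Definition sh_equiv X Y (f f' : sh_rep X Y) : Prop :=
  canon_iso (sh_tgt f) (sh_tgt f') ∘ sh_mor f =
  sh_mor f' ∘ canon_iso (sh_src f) (sh_src f').

Lemma sh_equiv_refl X Y (f : sh_rep X Y) : sh_equiv f f.
Proof. by rewrite /sh_equiv !canon_iso_id mcomp_idl mcomp_idr. Qed.

Lemma sh_equiv_sym X Y (f g : sh_rep X Y) : sh_equiv f g -> sh_equiv g f.
Proof.
rewrite /sh_equiv => e.
rewrite -[sh_mor g]mcomp_idr -(canon_isoK (sh_src g) (sh_src f)) (mcompA (sh_mor g)) -e.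
by rewrite !mcompA canon_isoK mcomp_idl.
Qed.

Lemma sh_equiv_trans X Y (f g h : sh_rep X Y) :
  sh_equiv f g -> sh_equiv g h -> sh_equiv f h.
Proof.
rewrite /sh_equiv => fg gh.
rewrite -(canon_iso_comp _ (sh_tgt g)) -mcompA fg mcompA gh -mcompA.
by rewrite canon_iso_comp.
Qed.

Definition sh_eqrel X Y : equivalence_on (sh_rep X Y) :=
  EqRel (@sh_equiv_refl X Y) (@sh_equiv_sym X Y) (@sh_equiv_trans X Y).

Definition Sh X Y : Type := quot (sh_eqrel X Y).

Definition sh_comp_rep X Y Z (g : sh_rep Y Z) (f : sh_rep X Y) : sh_rep X Z :=
  ShRep (sh_mor g ∘ canon_iso (sh_tgt f) (sh_src g) ∘ sh_mor f).

Definition sh_comp X Y Z (G : Sh Y Z) (F : Sh X Y) : Sh X Z :=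
  cls (sh_eqrel X Z) (sh_comp_rep (rep G) (rep F)).

Lemma sh_compE X Y Z (g : sh_rep Y Z) (f : sh_rep X Y) :
  sh_comp (cls (sh_eqrel Y Z) g) (cls (sh_eqrel X Y) f) =
  cls (sh_eqrel X Z) (sh_comp_rep g f).
Proof.
apply/clsP.
have := rep_cls (sh_eqrel Y Z) g; have := rep_cls (sh_eqrel X Y) f.
move: (rep _) (rep _) => f' g' /= ff' gg'; rewrite /sh_equiv /=.
rewrite -[RHS]mcompA -ff' !mcompA gg'.
by congr (_ ∘ _); rewrite -!mcompA !canon_iso_comp.
Qed.

(* The coarse shape morphism S*(f), computed with chosen expansions of the two
   spaces; [sh_of_indep] shows that the choice does not matter. *)
Definition sh_of X Y (p : expansion X) (q : expansion Y)
    (f : @Mor (HTop R) X Y) : Sh X Y :=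
  cls (sh_eqrel X Y) (ShRep (pro_incl (induced p q f))).

Lemma sh_of_indep X Y (p p' : expansion X) (q q' : expansion Y)
    (f : @Mor (HTop R) X Y) : sh_of p q f = sh_of p' q' f.
Proof.
have e : canon_iso q q' ∘ pro_incl (induced p q f) =
    pro_incl (induced p' q' f) ∘ canon_iso p p'.
  rewrite /canon_iso -!pro_incl_comp !induced_comp.
  by rewrite mcomp_idl mcomp_idr.
exact/clsP.
Qed.

(* A space in HPol is its own expansion. *)
Definition self_expansion P (hP : HPol R P) : expansion P.
Proof.
refine (@Expansion P (@const_sys (HTop R) P) (fun=> @mid (HTop R) P) _ _ _ _).
- by move=> l l' h; exact: mcomp_idl.
- by [].
- by move=> Q _ h; exists ord0, h; rewrite mcomp_idr.
- move=> Q _ l f0 f1; rewrite !mcomp_idr => ->.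
  by exists ord0, (point_le _ _).
Defined.

(* d(F, G) = {m | q_m o F = q_m o G}, with q_m standing for S*(q_m). *)
Definition agreement X Y (q : expansion Y) (F G : Sh X Y) :
    set (sys_ix (exp_sys q)) :=
  [set m | let qm := sh_of q (self_expansion (exp_HPol m)) (exp_proj m) in
           sh_comp qm F = sh_comp qm G].

End CoarseShape.

Arguments agreement {R X Y} q F G.

Record lower_class (M : directedSet) := LowerClass {
  lower_set :> set M;
  lowerP : forall (d m : M), lower_set d -> (m <= d)%O -> lower_set m }.

Section LowerClass.
Variable M : directedSet.

HB.instance Definition _ := gen_eqMixin (lower_class M).
HB.instance Definition _ := gen_choiceMixin (lower_class M).

Definition lower_le (D D' : lower_class M) : bool := `[< D' `<=` D >].

Lemma lower_eq (D D' : lower_class M) : D = D' :> set M -> D = D'.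
Proof.
case: D D' => [D hD] [D' hD'] /= e; case: _ / e hD' => hD'.
by congr LowerClass; exact: Prop_irrelevance.
Qed.

Lemma lower_le_refl : reflexive lower_le.
Proof. by move=> D; apply/asboolP. Qed.

Lemma lower_le_anti : antisymmetric lower_le.
Proof.
move=> D D' /andP[/asboolP D'D /asboolP DD'].
by apply: lower_eq; apply/seteqP.
Qed.

Lemma lower_le_trans : transitive lower_le.
Proof.
move=> D D' D'' /asboolP DD' /asboolP D''D; apply/asboolP.
exact: subset_trans DD'.
Qed.

Fact lower_display : Order.disp_t. Proof. by []. Qed.

HB.instance Definition _ := Order.Le_isPOrder.Build lower_display (lower_class M)
  lower_le_refl lower_le_anti lower_le_trans.

Definition lower_all : lower_class M :=
  @LowerClass M setT (fun _ _ _ _ => I).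

Lemma lower_all_le (D : lower_class M) : (lower_all <= D)%O.
Proof. exact/asboolP. Qed.

HB.instance Definition _ := Order.hasBottom.Build lower_display (lower_class M)
  lower_all_le.

End LowerClass.

Definition ultrametric (S : Type) (disp : Order.disp_t)
    (Gamma : bPOrderType disp) (d : S -> S -> Gamma) : Prop :=
  [/\ forall x y, d x y = \bot%O <-> x = y,
      forall x y, d x y = d y x &
      forall x y z (g : Gamma),
        (d x y <= g)%O -> (d y z <= g)%O -> (d x z <= g)%O].

(* Main.v *)
(* Transported along the canonical isomorphisms, F and G become classes of
   S*-morphisms f, g between one expansion p of X and q, and q_m o F is then
   represented by the sequence of the m-th components of f. So m lies in
   d(F, G) iff the m-th components of f and g agree in the sense that defines
   equivalence of S*-morphisms: at all m this says F = G, and the coherence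
   condition carries agreement at m' down to every m <= m'. *)
Require Import Defs.
From mathcomp Require Import all_boot all_order all_algebra.
From mathcomp Require Import all_classical all_reals topology normedtype.

Set Implicit Arguments.
Unset Strict Implicit.
Import Order.TTheory.

(** Coherence replaces each [m]-th component by the bond after the [m']-th one, and composing with a
    fixed bond preserves agreement. *)
Lemma agree_star_lower (T : category) (X Y : invsys T) (f g : star_mor X Y)
    (m m' : sys_ix Y) :
  (m <= m')%O ->
  agree (fun n => star_fun f n m') (fun n => star_fun g n m') ->
  agree (fun n => star_fun f n m) (fun n => star_fun g n m).
Proof.
move=> h fg; apply: agree_trans (agree_sym (star_coh f h)) _.
apply: agree_trans (star_coh g h).
exact: (agree_post (fun=> bond Y h) fg).
Qed.

Section Agreement.
Variable R : realType.
Implicit Types X Y : topologicalType.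

Definition sh_cls X Y (p : expansion R X) (q : expansion R Y)
    (f : star_mor (exp_sys p) (exp_sys q)) : Sh R X Y :=
  cls (sh_eqrel R X Y) (@ShRep R X Y p q (cls (star_eqrel _ _) f)).

Lemma sh_clsP X Y (p : expansion R X) (q : expansion R Y)
    (f g : star_mor (exp_sys p) (exp_sys q)) :
  sh_cls f = sh_cls g <-> star_equiv f g.
Proof.
rewrite /sh_cls clsP /= /sh_equiv /= !canon_iso_id mcomp_idl mcomp_idr.
exact: clsP.
Qed.

(** Conjugation by canonical isomorphisms moves any representative to the prescribed expansions, so
    two morphisms can be compared componentwise. *)
Lemma sh_cls_surj X Y (p : expansion R X) (q : expansion R Y) (F : Sh R X Y) :
  exists f : star_mor (exp_sys p) (exp_sys q), F = sh_cls f.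
Proof.
elim/cls_ind: F => -[p' q' u].
exists (rep (canon_iso q' q ∘ u ∘ canon_iso p p')).
rewrite /sh_cls repK; apply/clsP; rewrite /= /sh_equiv /=.
by rewrite -[RHS]mcompA canon_isoK mcomp_idr.
Qed.

Lemma self_proj_coh Y (q : expansion R Y) (k : sys_ix (exp_sys q))
    (m m' : sys_ix (exp_sys (self_expansion (exp_HPol k)))) (h : (m <= m')%O) :
  exists (l : sys_ix (exp_sys q)) (h1 h2 : (k <= l)%O),
    bond (exp_sys (self_expansion (exp_HPol k))) h ∘ mid (exp_sys q k)
      ∘ bond (exp_sys q) h2 = mid (exp_sys q k) ∘ bond (exp_sys q) h1.
Proof. by exists k, (lexx k), (lexx k); rewrite /= mcomp_idl. Qed.

(** The morphism of systems that represents [q_k]: its target is the one-term system on [Y_k],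
    reached by the identity at index [k]. *)
Definition self_proj Y (q : expansion R Y) (k : sys_ix (exp_sys q)) :
    pro_mor (exp_sys q) (exp_sys (self_expansion (exp_HPol k))) :=
  @ProMor _ (exp_sys q) (exp_sys (self_expansion (exp_HPol k))) (fun=> k)
    (fun=> mid (exp_sys q k)) (@self_proj_coh Y q k).

Lemma induced_self_proj Y (q : expansion R Y) (k : sys_ix (exp_sys q)) :
  induced q (self_expansion (exp_HPol k)) (exp_proj k) =
  cls (pro_eqrel _ _) (self_proj k).
Proof.
by apply: induced_unique (induced_compatible _ _ _) _; exact/compatibleP.
Qed.

Lemma agreementP X Y (p : expansion R X) (q : expansion R Y)
    (f g : star_mor (exp_sys p) (exp_sys q)) (k : sys_ix (exp_sys q)) :
  agreement q (sh_cls f) (sh_cls g) k <->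
  agree (fun n => star_fun f n k) (fun n => star_fun g n k).
Proof.
(* The morphisms being composed meet in the same expansion [q], so the canonical isomorphism between
   them is an identity. *)
have comp_proj h : sh_comp (sh_of q (self_expansion (exp_HPol k)) (exp_proj k))
    (sh_cls h) =
    @sh_cls X _ p (self_expansion (exp_HPol k)) (star_comp (pro_star (self_proj k)) h).
  rewrite /sh_of induced_self_proj pro_inclE /sh_cls sh_compE.
  by rewrite /sh_comp_rep /= canon_iso_id mcomp_idr prostar_clsE.
have proj_agree (h : star_mor (exp_sys p) (exp_sys q)) :
    agree (fun n => mid (exp_sys q k) ∘ star_fun h n k) (fun n => star_fun h n k).
  by apply: (@agree_eventually _ _ _ _ _ _ 0%N) => n _; rewrite mcomp_idl.
rewrite /agreement /= !comp_proj sh_clsP; split=> [fg|fg _ /=].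
  exact: agree_trans (agree_sym (proj_agree f)) (agree_trans (fg ord0) (proj_agree g)).
exact: agree_trans (proj_agree f) (agree_trans fg (agree_sym (proj_agree g))).
Qed.

Lemma agreement_lower X Y (q : expansion R Y) (F G : Sh R X Y)
    (m' m : sys_ix (exp_sys q)) :
  agreement q F G m' -> (m <= m')%O -> agreement q F G m.
Proof.
(* Any expansion of [X] serves as common source; a representative of [F] supplies one. *)
have p := sh_src (rep F).
have [f ->] := sh_cls_surj p q F; have [g ->] := sh_cls_surj p q G.
by move=> /agreementP fg mm'; apply/agreementP/(agree_star_lower mm').
Qed.

Lemma agreement_setT X Y (q : expansion R Y) (F G : Sh R X Y) :
  agreement q F G = setT <-> F = G.
Proof.
split=> [FG|->]; last by apply/seteqP.
have p := sh_src (rep F); move: FG.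
have [f ->] := sh_cls_surj p q F; have [g ->] := sh_cls_surj p q G => fg.
by apply/sh_clsP => m; apply/agreementP; rewrite fg.
Qed.

End Agreement.

Theorem theorem3p8 (R : realType) (X Y : topologicalType) (q : expansion R Y) :
  exists d : Sh R X Y -> Sh R X Y -> lower_class (sys_ix (exp_sys q)),
    (forall F G : Sh R X Y, lower_set (d F G) = agreement q F G) /\
    ultrametric d.
Proof.
pose d F G : lower_class (sys_ix (exp_sys q)) :=
  LowerClass (@agreement_lower R X Y q F G).
exists d; split=> //; split.
- move=> F G; split=> [/(congr1 (@lower_set _))/agreement_setT //|FG].
  by apply: lower_eq; exact/agreement_setT.
- by move=> F G; apply: lower_eq; apply/seteqP; split=> m /= /esym.
(* The order is reverse inclusion: [D] lies in both agreement sets, and at each index of [D] the two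
   equalities chain. *)
- move=> F G H D /asboolP FG /asboolP GH; apply/asboolP => m Dm.
  exact: etrans (FG m Dm) (GH m Dm).
Qed.
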